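(* The FIFO algorithm has approximation ratio at least $\Omega(\log m)$ for the maximum flow-time minimization problem with machine closing times on $m$ machines. That is, there is an absolute constant $c>0$ such that for every $m \ge 2$ there is an instance with $m$ machines on which the maximum flow-time of the schedule produced by FIFO is at least $c \log m$ times the minimum possible maximum flow-time of a feasible schedule.
   Context: Maximum flow-time minimization with machine closing times: there are $m$ machines $M=[m]$ and $n$ jobs $J=[n]$. Each machine $i \in M$ has a closing time $b_i \ge 0$. Each job $j \in J$ has a release time $r_j \ge 0$ and a processing time $d_j \ge 0$. Job $j$ can be scheduled on machine $i$ if and only if $r_j \le b_i$ (the processing itself may take place after time $b_i$). A feasible schedule assigns each job to a single machine on which it can be scheduled, and processes each job $j$ on its machine for $d_j$ units of time, without interruption, starting no earlier than $r_j$, each machine processing at most one job at a time. If $C_j$ is the completion time of job $j$, its flow-time is $C_j - r_j$; the objective is to minimize $\max_{j\in J}(C_j - r_j)$. FIFO (first-in-first-out): order the jobs by release times and assign them one by one in this order; each job $j$ is assigned, among the machines on which it can be scheduled (those with $b_i \ge r_j$), to the machine with the least remaining processing time (at time $r_j$) of the jobs that have already been assigned to it (ties broken arbitrarily). Each machine processes the jobs assigned to it in the order of assignment, without unnecessary idling. *)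

(* Defs.v *)
(* Maximum flow-time minimization with machine closing times, over an
   arbitrary realType R (MathComp / MathComp-Analysis). *)
From HB Require Import structures.
From mathcomp Require Import all_boot all_order all_algebra perm.
From mathcomp Require Import reals exp.

Set Implicit Arguments.
Unset Strict Implicit.
Unset Printing Implicit Defensive.

Import Order.TTheory GRing.Theory Num.Theory.
Local Open Scope ring_scope.

Record instance (R : realType) (m : nat) := Instance {
  njobs : nat;
  closing : 'I_m -> R;
  release : 'I_njobs -> R;
  ptime : 'I_njobs -> R;
  closing_ge0 : forall i, 0 <= closing i;
  release_ge0 : forall j, 0 <= release j;
  ptime_ge0 : forall j, 0 <= ptime j
}.

Section Schedules.
Variables (R : realType) (m : nat) (I : instance R m).

Definition allowed (j : 'I_(njobs I)) (i : 'I_m) : bool :=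
  release j <= closing I i.

(* Processing is uninterrupted, so a machine and a starting time for each job
   determine the schedule. *)
Record schedule := Schedule {
  machine : 'I_(njobs I) -> 'I_m;
  start : 'I_(njobs I) -> R
}.

Definition completion (s : schedule) (j : 'I_(njobs I)) : R :=
  start s j + ptime j.

(* The processing interval is half-open, so that consecutive jobs may touch. *)
Definition running (s : schedule) (j : 'I_(njobs I)) (t : R) : bool :=
  start s j <= t < completion s j.

Definition feasible (s : schedule) : Prop :=
  [/\ forall j, allowed j (machine s j),
      forall j, release j <= start s j
    & forall j k t, machine s j = machine s k ->
        running s j t -> running s k t -> j = k].

Definition flow_time (s : schedule) (j : 'I_(njobs I)) : R :=
  completion s j - release j.

(* Flow-times are nonnegative as soon as no job starts before its release, so
   the default value 0 only matters when there are no jobs. *)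
Definition max_flow (s : schedule) : R :=
  \big[Num.max/0]_(j < njobs I) flow_time s j.

Definition is_min_max_flow (v : R) : Prop :=
  (exists2 s, feasible s & max_flow s = v) /\
  (forall s, feasible s -> v <= max_flow s).

(* The part of job k still to be processed at time t: ptime k before it starts,
   completion s k - t while it runs, 0 afterwards. *)
Definition remaining (s : schedule) (k : 'I_(njobs I)) (t : R) : R :=
  Num.max 0 (Num.min (ptime k) (completion s k - t)).

(* Here pos j is the position of job j in the order of assignment. *)
Definition load (pos : {perm 'I_(njobs I)}) (s : schedule)
    (j : 'I_(njobs I)) (i : 'I_m) : R :=
  \sum_(k | (pos k < pos j)%N && (machine s k == i)) remaining s k (release j).

(* s is a possible output of FIFO when jobs are assigned in the order pos.
   The third clause leaves the choice among least loaded machines free. The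
   fourth says that a machine starts each of its jobs as soon as the job is
   released and all jobs assigned earlier to that machine are completed. *)
Definition fifo_with (pos : {perm 'I_(njobs I)}) (s : schedule) : Prop :=
  [/\ forall j k, (pos j < pos k)%N -> release j <= release k,
      forall j, allowed j (machine s j),
      forall j i, allowed j i -> load pos s j (machine s j) <= load pos s j i
    & forall j, start s j =
        \big[Num.max/release j]_(k | (pos k < pos j)%N &&
                                     (machine s k == machine s j))
          completion s k].

(* Neither the order of simultaneously released jobs nor the tie-breaking
   between machines is prescribed: one instance may have several outputs. *)
Definition fifo (s : schedule) : Prop := exists pos, fifo_with pos s.

End Schedules.

(* Main.v *)
(* Let 2 ^ K <= m.  Jobs of size 2 are released at unit time steps in levels
   e = K, ..., 0; level e has 2 ^ e jobs, and exactly the machines i < 2 ^ e are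
   still open for it.  The optimum puts the jobs of level e in pairs on the
   2 ^ (e - 1) machines that are about to close, so that no machine serves two
   levels and every flow-time is at most 4.  FIFO must spread each level evenly
   over all open machines, whatever the ties, so backlog accumulates by one unit
   per level on the last machine.  The only job of level 0 has size 4, which
   makes the optimum exactly 4, while its flow-time under FIFO is K + 4.

   Job j is the node j + 1 of a binary heap, and its level is the depth. *)
Require Import Defs.
From HB Require Import structures.
From mathcomp Require Import all_boot all_order all_algebra perm.
From mathcomp Require Import reals exp.
From mathcomp Require Import zify lra.

Set Implicit Arguments.
Unset Strict Implicit.
Unset Printing Implicit Defensive.

Import Order.TTheory GRing.Theory Num.Theory.
Local Open Scope ring_scope.

(** * Levels of the heap *)

Definition level (j : nat) : nat := trunc_log 2 j.+1.

Lemma level_bounds j : (2 ^ level j <= j.+1 < 2 ^ (level j).+1)%N.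
Proof. exact: trunc_log_bounds. Qed.

Lemma level_eq e j : (2 ^ e <= j.+1 < 2 ^ e.+1)%N -> level j = e.
Proof. exact: trunc_log_eq. Qed.

Lemma level_gt0 j : (0 < level j)%N -> j != 0%N.
Proof. by case: j => // /=; rewrite /level trunc_log1. Qed.

Lemma leq_level j k : (j <= k)%N -> (level j <= level k)%N.
Proof. by move=> jk; apply: leq_trunc_log. Qed.

Lemma expn2_double e : (2 ^ e.+1 = 2 ^ e + 2 ^ e)%N.
Proof. by rewrite expnS mul2n addnn. Qed.

Lemma level_job_le K (j : 'I_((2 ^ K.+1).-1)) : (level j <= K)%N.
Proof.
have /andP[lj _] := level_bounds j.
rewrite -ltnS -(ltn_exp2l _ _ (isT : (1 < 2)%N)).
have := ltn_ord j; lia.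
Qed.

Lemma card_level K e : (e <= K)%N ->
  #|[set j : 'I_((2 ^ K.+1).-1) | level j == e]| = (2 ^ e)%N.
Proof.
move=> eK.
have e2 : (0 < 2 ^ e)%N by rewrite expn_gt0.
have eK2 : (2 ^ e <= 2 ^ K)%N by rewrite leq_exp2l.
(* The heap nodes of depth [e] are [2 ^ e + i] with [i < 2 ^ e]; job numbers are one less. *)
have bnd (i : 'I_(2 ^ e)) : ((2 ^ e + i).-1 < (2 ^ K.+1).-1)%N.
  by have := ltn_ord i; rewrite (expn2_double K); lia.
have -> : [set j : 'I_((2 ^ K.+1).-1) | level j == e] =
          [set Ordinal (bnd i) | i in [set: 'I_(2 ^ e)]].
  apply/setP => j; rewrite inE; apply/eqP/imsetP => [je | [i _ ->]].
    have := level_bounds j; rewrite je (expn2_double e) => /andP[lo hi].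
    have ri : (j.+1 - 2 ^ e < 2 ^ e)%N by lia.
    by exists (Ordinal ri) => //; apply: val_inj => /=; lia.
  by apply: level_eq => /=; have := ltn_ord i; rewrite (expn2_double e); lia.
rewrite card_imset ?cardsT ?card_ord // => i i' /(congr1 val) /= ii'.
by apply: val_inj => /=; lia.
Qed.

Lemma card_ord_lt m n : (n <= m)%N -> #|[set i : 'I_m | (i < n)%N]| = n.
Proof.
move=> nm.
have -> : [set i : 'I_m | (i < n)%N] = [set widen_ord nm i | i in [set: 'I_n]].
  apply/setP => i; rewrite inE; apply/idP/imsetP => [i_n | [i' _ ->]] //=.
  by exists (Ordinal i_n); [rewrite inE | apply: val_inj].
rewrite card_imset ?cardsT ?card_ord // => i i' /(congr1 val) /= ii'.
exact: val_inj.
Qed.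

(** [uphalf j] is the parent of heap node [j + 1], hence one level higher up. *)
Lemma level_uphalf j : (0 < j)%N -> level j = (trunc_log 2 (uphalf j)).+1.
Proof. by move=> j0; rewrite /level trunc_log2S. Qed.

(** * The instance *)

Section HeapInstance.
Variables (R : realType) (K m : nat).
Hypothesis Km : (2 ^ K <= m)%N.

Let job := 'I_((2 ^ K.+1).-1).

Lemma root_job_subproof : (0 < (2 ^ K.+1).-1)%N.
Proof. by have := expn_gt0 2 K; rewrite expn2_double; lia. Qed.

Definition root_job : job := Ordinal root_job_subproof.

(** [up_log 2 i.+1] is the least level for which machine [i] is open. The offset [K.+1] keeps all
    releases at least 1, so machines [i >= 2 ^ K], whose closing time truncates to 0, receive no
    job. *)
Definition heap_closing (i : 'I_m) : R := (K.+1 - up_log 2 i.+1)%N%:R.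
Definition heap_release (j : job) : R := (K.+1 - level j)%N%:R.
Definition heap_ptime (j : job) : R := if val j == 0%N then 4 else 2.

Lemma heap_closing_ge0 i : 0 <= heap_closing i.
Proof. exact: ler0n. Qed.

Lemma heap_release_ge0 j : 0 <= heap_release j.
Proof. exact: ler0n. Qed.

Lemma heap_ptime_ge0 j : 0 <= heap_ptime j.
Proof. by rewrite /heap_ptime; case: ifP. Qed.

Definition heap_instance : instance R m :=
  Instance heap_closing_ge0 heap_release_ge0 heap_ptime_ge0.

Local Notation I := heap_instance.
Implicit Types (s : schedule I) (pos : {perm job}) (j k : job) (i : 'I_m).

Lemma heap_allowed j i : allowed (I := I) j i = (i < 2 ^ level j)%N.
Proof.
rewrite /allowed /= /heap_release /heap_closing ler_nat.
have lj := level_job_le j.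
have [u|u] := leqP i.+1 (2 ^ level j).
  by have := up_log_min (isT : (1 < 2)%N) u; lia.
have : (level j < up_log 2 i.+1)%N.
  rewrite ltnNge; apply: contraL u => u; rewrite -leqNgt.
  apply: leq_trans (up_logP _ (isT : (1 < 2)%N)) _.
  by rewrite leq_exp2l.
lia.
Qed.

Lemma heap_release_lt j k : (heap_release j < heap_release k) = (level k < level j)%N.
Proof.
rewrite ltr_nat; have := level_job_le j; have := level_job_le k; lia.
Qed.

Lemma expn_level_leq j : (2 ^ level j <= m)%N.
Proof. by apply: leq_trans Km; rewrite leq_exp2l ?level_job_le. Qed.

(** * The optimal schedule *)

Lemma opt_machine_subproof j : (uphalf j < m)%N.
Proof.
apply: leq_trans (expn_level_leq j).
have := level_bounds j; rewrite (expn2_double (level j)); lia.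
Qed.

(* With jobs numbered as the nodes 1, 2, ... of a binary heap, each job runs on
   the machine numbered by its parent, siblings running one after the other. *)
Definition opt_schedule : schedule I :=
  @Schedule _ _ I (fun j => Ordinal (opt_machine_subproof j))
    (fun j => heap_release j + if odd j then 2 else 0).

Lemma opt_schedule_feasible : feasible opt_schedule.
Proof.
split=> /=.
- move=> j; rewrite heap_allowed /=.
  have := level_bounds j; rewrite (expn2_double (level j)); lia.
- by move=> j /=; rewrite lerDl; case: ifP.
- move=> j k t /(congr1 val) /= jk.
  rewrite /running /completion /= => /andP[j1 j2] /andP[k1 k2].
  apply/val_inj/eqP => /=; apply: contraT => neq.
  (* [uphalf] vanishes only at 0, so the root is alone on machine 0; distinct jobs sharing a machine
     are siblings of opposite parity. *)
  have [j0 k0] : (0 < j)%N /\ (0 < k)%N by lia.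
  have ljk : level j = level k by rewrite !level_uphalf // jk.
  have {neq} odd_jk : odd j != odd k by lia.
  move: j1 j2 k1 k2; rewrite /heap_release /heap_ptime ljk !gtn_eqF //.
  by move: odd_jk; case: (odd j); case: (odd k) => //= _; lra.
Qed.

Lemma opt_schedule_max_flow : max_flow opt_schedule = 4.
Proof.
apply/le_anti/andP; split.
  apply: bigmax_le => // j _; rewrite /flow_time /completion /= /heap_ptime.
  by case: j => -[|j] jN /=; [|case: ifP => _]; lra.
apply: le_trans (le_bigmax _ _ root_job).
by rewrite /flow_time /completion /= /heap_ptime /=; lra.
Qed.

Lemma feasible_max_flow_ge s : feasible s -> 4 <= max_flow s.
Proof.
case=> _ rel _.
apply: le_trans (le_bigmax _ _ root_job).
have := rel root_job.
by rewrite /flow_time /completion /= /heap_ptime /=; lra.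
Qed.

Lemma heap_is_min_max_flow : is_min_max_flow I 4.
Proof.
split; last exact: feasible_max_flow_ge.
by exists opt_schedule; [exact: opt_schedule_feasible|exact: opt_schedule_max_flow].
Qed.

(** * FIFO schedules *)

(** Level [K] starts at its release time 1, and each next level 2 units later. As level [e] is
    released at [K + 1 - e], it waits [K - e]. *)
Definition fifo_start (e : nat) : R := (K - e).*2.+1%:R.

(** Invariant of the descending induction on levels. The [pred1] form lets a sum over the jobs of
    one level on one machine collapse to a single term. *)
Definition balanced s (e : nat) : Prop :=
  (forall j, level j = e -> start s j = fifo_start e) /\
  (forall i, (i < 2 ^ e)%N ->
     exists j, (fun k => (level k == e) && (machine s k == i)) =1 pred1 j).

Definition respects_release pos : Prop :=
  forall j k, (pos j < pos k)%N -> heap_release j <= heap_release k.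

Lemma respects_release_level pos j k : respects_release pos ->
  (pos j < pos k)%N -> (level k <= level j)%N.
Proof. by move=> rp /rp; rewrite leNgt heap_release_lt -leqNgt. Qed.

Lemma respects_release_pos pos j k : respects_release pos ->
  (level k < level j)%N -> (pos j < pos k)%N.
Proof.
move=> rp kj; rewrite ltnNge leq_eqVlt negb_or; apply/andP; split.
  by apply: contraTN kj => /eqP/val_inj/perm_inj ->; rewrite ltnn.
by apply: contraTN kj => /(respects_release_level rp); rewrite -leqNgt.
Qed.

(** The maximum is attained by the job one level deeper on the same machine, which was already open
    then; at level [K] it is the release time. *)
Lemma bigmax_completion pos s j :
  respects_release pos -> (forall k, allowed (I := I) k (machine s k)) ->
  (forall e, (level j < e <= K)%N -> balanced s e) ->
  (forall k, level k = level j -> machine s k = machine s j -> k = j) ->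
  \big[Num.max/@release _ _ I j]_(k | (pos k < pos j)%N &&
      (machine s k == machine s j)) completion s k = fifo_start (level j).
Proof.
move=> rp al bal inj; have lj := level_job_le j.
have comp k : (level j < level k)%N -> completion s k = (K - level k).*2.+3%:R.
  move=> jk; rewrite /completion (bal (level k) _).1 ?jk ?level_job_le //=.
  rewrite /heap_ptime; have /level_gt0/negPf -> : (0 < level k)%N by lia.
  by rewrite /fifo_start -natrD addn2.
apply/le_anti/andP; split.
  apply: bigmax_le => [|k /andP[pkj /eqP mkj]].
    by rewrite /= /heap_release ler_nat; lia.
  have jk : (level j < level k)%N.
    have := respects_release_level rp pkj; rewrite leq_eqVlt => /orP[/eqP ljk|//].
    by move: pkj; rewrite (inj k) ?ltnn.
  by rewrite comp // ler_nat; have := level_job_le k; lia.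
have [ltjK|] := ltnP (level j) K; last first.
  move=> Kj; apply: le_trans (bigmax_ge_id _ _ _ _).
  by rewrite /= /heap_release ler_nat; lia.
have mj : (machine s j < 2 ^ (level j).+1)%N.
  have := al j; rewrite heap_allowed => /leq_trans; apply.
  by rewrite leq_exp2l.
have jK : (level j < (level j).+1 <= K)%N by rewrite ltnSn.
have [k /(_ k)] := (bal _ jK).2 _ mj; rewrite /= eqxx => /andP[/eqP lk /eqP mk].
apply: (@le_trans _ _ (completion s k)); first by rewrite comp ?ler_nat; lia.
apply: le_bigmax_cond; rewrite mk eqxx andbT.
by apply: respects_release_pos => //; lia.
Qed.

(* The work left over from earlier levels is the same on every open machine. *)
Lemma load_split pos s j i :
  respects_release pos -> (i < 2 ^ level j)%N ->
  (forall e, (level j < e <= K)%N -> balanced s e) ->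
  load (I := I) pos s j i =
  \sum_(e < K.+1 | (level j < e)%N)
    Num.max 0 (Num.min 2 (fifo_start e + 2 - heap_release j)) +
  \sum_(k | [&& (pos k < pos j)%N, machine s k == i & level k == level j])
    remaining s k (heap_release j).
Proof.
move=> rp ij bal; rewrite /load (bigID (fun k => level k == level j)) /= addrC.
congr (_ + _); last by apply: eq_bigl => k; rewrite andbA.
have lev k : (level k < K.+1)%N by rewrite ltnS level_job_le.
rewrite (eq_bigl (fun k => (level j < level k)%N && (machine s k == i))); last first.
  move=> k; rewrite andbAC; congr andb; apply/andP/idP => [[pkj kj]|jk].
    by rewrite ltn_neqAle eq_sym kj (respects_release_level rp).
  by rewrite (respects_release_pos rp) // gtn_eqF.
rewrite (partition_big (fun k => Ordinal (lev k)) (fun e => level j < e)%N) /=; last first.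
  by move=> k /andP[].
apply: eq_bigr => e je.
have eK : (e <= K)%N by rewrite -ltnS.
have [] := bal e _; first by rewrite je.
move=> st /(_ i) []; first by apply: leq_trans ij _; rewrite leq_exp2l // ltnW.
move=> k0 k0P.
(* Balance leaves one job of level [e] on machine [i]; it is not the root, so its size is 2. *)
rewrite (eq_bigl (pred1 k0)) => [|k]; last first.
  rewrite -k0P /=; have -> : (Ordinal (lev k) == e) = (level k == e) by [].
  by rewrite andbC; case: eqP => //= ->; rewrite je.
have := k0P k0; rewrite /= eqxx => /andP[/eqP lk0 _].
rewrite big_pred1_eq /remaining /completion st //= /heap_ptime.
by have /level_gt0/negPf -> : (0 < level k0)%N by lia.
Qed.

(** An injection of the [2 ^ e] jobs of a level into the [2 ^ e] open machines is onto. *)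
Lemma level_machine_bij s (e : nat) : (e <= K)%N ->
  (forall k, allowed (I := I) k (machine s k)) ->
  (forall j k, level j = e -> level k = e -> machine s j = machine s k -> j = k) ->
  forall i, (i < 2 ^ e)%N ->
     exists j, (fun k => (level k == e) && (machine s k == i)) =1 pred1 j.
Proof.
move=> eK al inj i ie.
have : machine s @: [set j : job | level j == e] == [set i : 'I_m | (i < 2 ^ e)%N].
  rewrite eqEcard card_in_imset; last first.
    by move=> j k; rewrite !inE => /eqP je /eqP ke; exact: inj.
  rewrite card_level // card_ord_lt ?leqnn ?andbT; last first.
    by apply: leq_trans Km; rewrite leq_exp2l.
  apply/subsetP => _ /imsetP[j + ->]; rewrite !inE => /eqP je.
  by have := al j; rewrite heap_allowed je.
move=> /eqP/setP/(_ i); rewrite inE ie => /imsetP[j + ->]; rewrite inE => /eqP je.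
exists j => k /=; apply/andP/eqP => [[/eqP ke /eqP mk]|->]; last by rewrite je !eqxx.
exact: inj.
Qed.

Lemma remaining_gt0 s k : heap_release k <= start s k ->
  0 < remaining s k (heap_release k).
Proof.
move=> rs; rewrite /remaining /completion lt_max lt_min; apply/orP; right.
have p0 : 0 < heap_ptime k by rewrite /heap_ptime; case: ifP.
by rewrite /= p0 /=; lra.
Qed.

(* Were two jobs of a level on the same machine, some open machine would have
   received no other job of that level: it carries only the common leftover
   work, so the later of the two jobs should have gone there. *)
Lemma fifo_level_inj pos s (e : nat) : fifo_with (I := I) pos s -> (e <= K)%N ->
  (forall e', (e < e' <= K)%N -> balanced s e') ->
  forall j k, level j = e -> level k = e -> machine s j = machine s k -> j = k.
Proof.
case=> rp al min st eK bal j k je ke mjk; apply/eqP; apply: contraT => neq.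
wlog pjk : j k je ke mjk neq / (pos j < pos k)%N.
  move=> H; have [/H ->//|/H|/val_inj/perm_inj/eqP] := ltngtP (pos j) (pos k).
    by rewrite eq_sym; apply.
  by rewrite (negPf neq).
have [i ie iP] : exists2 i : 'I_m, (i < 2 ^ e)%N &
    i \notin machine s @: ([set j : job | level j == e] :\ k).
  have lt : (#|machine s @: ([set j : job | level j == e] :\ k)| <
             #|[set i : 'I_m | (i < 2 ^ e)%N]|)%N.
    apply: leq_ltn_trans (leq_imset_card _ _) _.
    rewrite card_ord_lt; last by apply: leq_trans Km; rewrite leq_exp2l.
    by rewrite -(card_level eK) [X in (_ < X)%N](cardsD1 k) inE ke eqxx.
  have : ~~ ([set i : 'I_m | (i < 2 ^ e)%N] \subset
             machine s @: ([set j : job | level j == e] :\ k)).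
    by apply: contraL lt => /subset_leq_card; rewrite -leqNgt.
  by case/subsetPn => i; rewrite inE => ie iP; exists i.
have rs k' : heap_release k' <= start s k' by rewrite st; exact: bigmax_ge_id.
have ali : allowed (I := I) k i by rewrite heap_allowed ke.
have alk : (machine s k < 2 ^ level k)%N by rewrite -heap_allowed; exact: al.
have balk e' : (level k < e' <= K)%N -> balanced s e' by rewrite ke; exact: bal.
have ik : (i < 2 ^ level k)%N by rewrite ke.
have := min k i ali.
rewrite (load_split rp alk balk) (load_split rp ik balk) lerD2l.
rewrite [X in _ <= X]big_pred0 => [|k']; last first.
  apply/negP => /and3P[pk' /eqP mk' lk']; case/imsetP: iP.
  by exists k' => //; rewrite !inE -ke lk' andbT; apply: contraTneq pk' => ->; rewrite ltnn.
rewrite leNgt (bigD1 j) /=; last by rewrite pjk mjk je ke !eqxx.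
move=> /negP; case; rewrite ltr_wpDr ?sumr_ge0 // => [k' _|].
  by rewrite /remaining le_max lexx.
have -> : heap_release k = heap_release j by rewrite /heap_release ke je.
exact: remaining_gt0.
Qed.

Lemma fifo_balanced pos s (e : nat) :
  fifo_with (I := I) pos s -> (e <= K)%N -> balanced s e.
Proof.
(* Induction on [K - e], since the deepest level is released first. *)
move=> fs; have [d] := ubnP (K - e); elim: d e => // d IH e ed eK.
have bal e' : (e < e' <= K)%N -> balanced s e'.
  by move=> /andP[ee' e'K]; apply: IH => //; lia.
have inj := fifo_level_inj fs eK bal.
have [rp al _ st] := fs; split; last exact: level_machine_bij.
move=> j je; rewrite st (bigmax_completion rp) ?je // => k ke mk.
exact: inj.
Qed.

(** The root is released at [K + 1], starts at [2K + 1] and has size 4. *)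
Lemma fifo_max_flow_ge s : fifo s -> K%:R + 4 <= max_flow s.
Proof.
case=> pos fs.
apply: le_trans (le_bigmax _ _ root_job).
rewrite /flow_time /completion (fifo_balanced fs (leq0n K)).1 /= /level ?trunc_log1 //.
rewrite /heap_ptime /heap_release /fifo_start /level trunc_log1 !subn0 -addnn.
by rewrite /= -[(K + K).+1%:R]natr1 -[K.+1%:R]natr1 natrD; lra.
Qed.

(** * An explicit FIFO output *)

Lemma fifo_machine_subproof j : (j.+1 - 2 ^ level j < m)%N.
Proof.
apply: leq_trans (expn_level_leq j).
have := level_bounds j; rewrite (expn2_double (level j)); lia.
Qed.

(** Witness that the bound on all FIFO outputs is not vacuous: each level fills its open machines
    from left to right. *)
Definition fifo_schedule : schedule I :=
  @Schedule _ _ I (fun j => Ordinal (fifo_machine_subproof j))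
    (fun j => fifo_start (level j)).

Lemma fifo_schedule_allowed j : allowed (I := I) j (machine fifo_schedule j).
Proof.
by rewrite heap_allowed /=; have := level_bounds j; rewrite (expn2_double (level j)); lia.
Qed.

Lemma fifo_schedule_inj j k : level j = level k ->
  machine fifo_schedule j = machine fifo_schedule k -> j = k.
Proof.
move=> ljk /(congr1 val) /=; rewrite ljk => jk; apply: val_inj => /=.
have := level_bounds j; have := level_bounds k; rewrite ljk; lia.
Qed.

Lemma fifo_schedule_fifo : fifo fifo_schedule.
Proof.
(* Reversed heap numbering assigns the deepest level first. *)
pose pos : {perm job} := perm (@rev_ord_inj _).
have pos_lt j k : (pos j < pos k)%N = (k < j)%N.
  by rewrite !permE /=; have := ltn_ord j; have := ltn_ord k; lia.
have rp : respects_release pos.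
  by move=> j k; rewrite pos_lt leNgt heap_release_lt -leqNgt => /ltnW/leq_level.
have bal e : (e <= K)%N -> balanced fifo_schedule e.
  move=> eK; split=> [j <-//|]; apply: level_machine_bij => //.
    exact: fifo_schedule_allowed.
  by move=> j k je ke; apply: fifo_schedule_inj; rewrite je.
exists pos; split=> //.
- exact: fifo_schedule_allowed.
- move=> j i; have := fifo_schedule_allowed j; rewrite !heap_allowed => alj ali.
  rewrite !(load_split rp) // => [|e /andP[_]|e /andP[_]]; try exact: bal.
  (* The leftovers cancel, and the chosen machine holds no earlier job of this level, so its load is
     minimal. *)
  rewrite lerD2l [X in X <= _]big_pred0 => [|k].
    by apply: sumr_ge0 => k _; rewrite /remaining le_max lexx.
  apply/negP => /and3P[pk /eqP mk /eqP lk].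
  by move: pk; rewrite (fifo_schedule_inj lk mk) ltnn.
- move=> j; rewrite (bigmax_completion rp) // => [k|e /andP[_]|k lk mk].
  + exact: fifo_schedule_allowed.
  + exact: bal.
  + exact: fifo_schedule_inj.
Qed.

End HeapInstance.

(** * The logarithmic bound *)

Lemma ln_nat_le (R : realType) (m K : nat) :
  (0 < m)%N -> (m < 2 ^ K.+1)%N -> ln (m%:R : R) <= K%:R + 1.
Proof.
move=> m0 mK; apply: (@le_trans _ _ (ln ((2 : R) ^+ K.+1))).
  by rewrite ler_ln ?posrE ?exprn_gt0 ?ltr0n // -natrX ler_nat ltnW.
rewrite lnXn // natr1 -[ln _ *+ _]mulr_natl ler_piMr //.
(* This is [ln 2 <= 1]. *)
by have := @le_ln1Dx R 1 ltac:(lra).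
Qed.

Theorem mainTheorem6 (R : realType) :
  exists c : R, 0 < c /\
    forall m : nat, (2 <= m)%N ->
      exists (I : instance R m) (opt : R),
        [/\ is_min_max_flow I opt,
            0 < opt,
            (exists s : schedule I, fifo s)
          & forall s : schedule I, fifo s -> c * ln (m%:R : R) * opt <= max_flow s].
Proof.
(* The constant cancels the optimum 4, leaving [ln m <= K + 1 <= K + 4] for [K = trunc_log 2 m]. *)
exists 4^-1; split=> [|m m2]; first by rewrite invr_gt0.
have m0 : (0 < m)%N by apply: leq_trans m2.
have /andP[Km mK] := trunc_log_bounds (isT : (1 < 2)%N) m0.
exists (heap_instance R (trunc_log 2 m) m), 4; split=> //.
- exact: heap_is_min_max_flow.
- by exists (fifo_schedule R Km); exact: fifo_schedule_fifo.
- move=> s /(fifo_max_flow_ge Km); apply: le_trans.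
  by have := ln_nat_le R m0 mK; lra.
Qed.
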